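(* Poisson distributions have the intersection property: let $\lambda>0$ and let $X$ be Poisson distributed with mean $\lambda$. Then for every integer $k\ge0$, $$\Pr\left(X<k\right)<\Phi\left(G(k)\right)<\Pr\left(X\leq k\right),$$ where $G$ is the signed log-likelihood of the Poisson distribution with mean $\lambda$ and $\Phi$ is the distribution function of the standard Gaussian.
   Context: The signed log-likelihood of the Poisson distribution $Po(\lambda)$ is $$G(k)=\begin{cases}-\left(2D\left(Po(k)\Vert Po(\lambda)\right)\right)^{1/2}, & k<\lambda,\\ +\left(2D\left(Po(k)\Vert Po(\lambda)\right)\right)^{1/2}, & k\ge\lambda,\end{cases}$$ where $D\left(Po(k)\Vert Po(\lambda)\right)=k\ln\frac{k}{\lambda}-k+\lambda$ is the information divergence, with $0\ln0=0$. *)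

(* Defs.v *)
From HB Require Import structures.
From mathcomp Require Import all_boot all_order all_algebra.
From mathcomp Require Import all_classical all_reals all_analysis.

Set Implicit Arguments.
Unset Strict Implicit.
Unset Printing Implicit Defensive.

Import Order.TTheory GRing.Theory Num.Theory.
Import numFieldNormedType.Exports.

Local Open Scope classical_set_scope.
Local Open Scope ring_scope.

(* [poisson_prob lam n A] ignores its [nat] argument [n], which is set to 0. *)
Definition poisson_distributed (d : measure_display) (T : measurableType d)
    (R : realType) (P : probability T R) (X : {RV P >-> nat}) (lam : R) : Prop :=
  forall A : set nat, distribution P X A = poisson_prob lam 0%N A.

(* D(Po(x) || Po(lam)); the first term vanishes at [x = 0], so that
   0 ln 0 = 0 holds. *)
Definition poisson_divergence (R : realType) (x lam : R) : R :=
  x * ln (x / lam) - x + lam.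

Definition signed_log_likelihood (R : realType) (lam x : R) : R :=
  if x < lam then - Num.sqrt (2 * poisson_divergence x lam)
  else Num.sqrt (2 * poisson_divergence x lam).

(* [normal_prob m s] is parametrized by the standard deviation [s]. *)
Definition std_normal_cdf (R : realType) (x : R) : \bar R :=
  normal_prob 0 1 `]-oo, x].

(* Main.v *)
(** Fix [k] and let the mean [l] of the Poisson distribution vary.  Writing
    [G l] for the signed log-likelihood of [k], the derivatives in [l] of
    [Pr (X <= k)] and of [Phi (G l)] are both [- l ^ k * exp (- l)] times a
    positive factor: the constant [1 / k!] for the former and, up to another
    constant, [A l = |1 - k / l| / sqrt (2 D l)] for the latter.  As [A] is
    decreasing, [Pr (X <= k) - Phi (G l)] first increases, then decreases, and
    its limits at [0] and [+oo] are nonnegative, so it is positive.  Likewise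
    [Phi (G l) - Pr (X < k)] is positive because [l * A l] is increasing.  Both
    monotonicities are instances of the monotone form of L'Hopital's rule at
    the double zero [l = k] of the divergence [D].  Since only strict
    monotonicity matters, no Stirling-type estimate is needed. *)
Require Import Defs.
From HB Require Import structures.
From mathcomp Require Import all_boot all_order all_algebra.
From mathcomp Require Import all_classical all_reals all_analysis.
From mathcomp Require Import ring lra.

Set Implicit Arguments.
Unset Strict Implicit.
Unset Printing Implicit Defensive.

Import Order.TTheory GRing.Theory Num.Theory.
Import numFieldNormedType.Exports.

Local Open Scope classical_set_scope.
Local Open Scope ring_scope.

(** * Strict monotonicity from the sign of the derivative *)

Lemma lt_of_derive_gt0 (R : realType) (f df : R -> R) (a b : R) : a < b ->
  (forall u : R, a < u < b -> is_derive u 1 f (df u)) ->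
  (forall u : R, a < u < b -> 0 < df u) ->
  (forall u : R, a <= u <= b -> {for u, continuous f}) -> f a < f b.
Proof.
move=> ab dfE df0 cf.
have [c] : exists2 c, c \in `]a, b[%R & f b - f a = df c * (b - a).
  apply: MVT => //.
  by apply: continuous_in_subspaceT => u; rewrite inE/= in_itv/=; exact: cf.
rewrite in_itv/= => cab E; rewrite -subr_gt0 E mulr_gt0 ?subr_gt0//.
exact: df0.
Qed.

Lemma lt_of_derive_lt0 (R : realType) (f df : R -> R) (a b : R) : a < b ->
  (forall u : R, a < u < b -> is_derive u 1 f (df u)) ->
  (forall u : R, a < u < b -> df u < 0) ->
  (forall u : R, a <= u <= b -> {for u, continuous f}) -> f b < f a.
Proof.
move=> ab dfE df0 cf; rewrite -ltrN2.
apply: (@lt_of_derive_gt0 R (- f) (fun u => - df u)) ab _ _ _ => u uab.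
- by apply: is_deriveN; exact: dfE.
- by rewrite oppr_gt0 df0.
- by apply: continuousN; exact: cf.
Qed.

Lemma is_derive_continuous (R : realType) (f : R -> R) (u l : R) :
  is_derive u 1 f l -> {for u, continuous f}.
Proof.
by move=> [fu _]; apply: differentiable_continuous; exact/derivable1_diffP.
Qed.

(** * Monotone form of L'Hopital's rule at a common zero *)

Section monotone_lhopital.
Context {R : realType} (f w dw r : R -> R) (x : R).
Hypothesis f'E : forall u : R, 0 < u -> is_derive u 1 f (r u * dw u).
Hypothesis w'E : forall u : R, 0 < u -> is_derive u 1 w (dw u).
Hypothesis fx : f x = 0.
Hypothesis wx : w x = 0.
Hypothesis dw_lt0 : forall u : R, 0 < u -> u < x -> dw u < 0.
Hypothesis dw_gt0 : forall u : R, 0 < u -> x < u -> 0 < dw u.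
Hypothesis r_incr : forall u v : R, 0 < u -> u < v -> r u < r v.

Let lt_right (a b : R) : 0 < a -> x <= a -> a < b -> w a < w b.
Proof.
move=> a0 xa ab; apply: (@lt_of_derive_gt0 R w dw) => // u /andP[au ub].
- by apply: w'E; lra.
- by apply: dw_gt0; lra.
- by apply: (@is_derive_continuous _ _ _ (dw u)); apply: w'E; lra.
Qed.

Let lt_left (a b : R) : 0 < a -> b <= x -> a < b -> w b < w a.
Proof.
move=> a0 xa ab; apply: (@lt_of_derive_lt0 R w dw) => // u /andP[au ub].
- by apply: w'E; lra.
- by apply: dw_lt0; lra.
- by apply: (@is_derive_continuous _ _ _ (dw u)); apply: w'E; lra.
Qed.

(** [w] strictly decreases up to [x], where it vanishes, and strictly increases afterwards. *)
Lemma valley_gt0 (u : R) : 0 < x -> 0 < u -> u != x -> 0 < w u.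
Proof.
move=> x0 u0; case: (ltgtP u x) => // ux _; rewrite -wx.
- exact: lt_left.
- exact: lt_right.
Qed.

(** Mean value theorem for [W * f - F * w], which takes equal values at [a] and [b]. As [x] is not
    interior to the interval, [dw c] is nonzero and cancels. *)
Let cauchy (a b : R) : 0 < a -> a < b -> (b <= x) || (x <= a) ->
  exists2 c, a < c < b & f b - f a = r c * (w b - w a).
Proof.
move=> a0 ab bxa.
pose W := w b - w a; pose F := f b - f a.
have d (u : R) : 0 < u -> is_derive u 1 (fun v => W * f v - F * w v)
    (W * (r u * dw u) - F * dw u).
  move=> u0; have := f'E u0; have := w'E u0 => w'u f'u.
  exact: is_deriveB.
have [c] : exists2 c, c \in `]a, b[%R & W * f b - F * w b - (W * f a - F * w a)
    = (W * (r c * dw c) - F * dw c) * (b - a).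
  apply: (@MVT R (fun v => W * f v - F * w v)
    (fun u => W * (r u * dw u) - F * dw u)); [exact: ab| |].
    by move=> u; rewrite in_itv/= => /andP[au ub]; apply: d; lra.
  apply: continuous_in_subspaceT => u; rewrite inE/= in_itv/= => /andP[au ub].
  by have u0 : 0 < u; [lra|exact: is_derive_continuous (d u u0)].
- rewrite in_itv/= => /andP[ac cb] E; exists c; first by rewrite ac.
  have dwc : dw c != 0.
    by case/orP: bxa => ?; [rewrite lt_eqF// dw_lt0|rewrite gt_eqF// dw_gt0];
      lra.
  have {}E : dw c * (b - a) * (r c * W - F) = 0.
    have z : W * f b - F * w b - (W * f a - F * w a) = 0 by rewrite /W /F; ring.
    by rewrite -z E; ring.
  move/eqP: E; rewrite mulf_eq0 mulf_eq0 (negbTE dwc)/= subr_eq0 gt_eqF//= => E.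
  by apply/esym/eqP; rewrite -subr_eq0.
Qed.

(* By Cauchy's mean value theorem the chord slopes of [f] against [w] are
   values of [r] at increasing points. *)
Lemma monotone_lhopital (s t : R) : 0 < x -> 0 < s -> s < t -> s != x -> t != x ->
  f s * w t < f t * w s.
Proof.
move=> x0 s0 st sx tx.
have t0 : 0 < t by lra.
have ws := valley_gt0 x0 s0 sx; have wt := valley_gt0 x0 t0 tx.
(* Both functions vanish at [x], so [f u / w u] is the chord slope between [u] and [x]. Across [x]
   the two slopes compare directly; on one side of [x], the slope over [[s, t]] is compared with the
   one between [x] and the nearer point. *)
case: (ltgtP s x) sx => // {}sx _.
- case: (ltgtP t x) tx => // {}tx _.
  + have [|c1 /andP[? ?] E1] := @cauchy s t s0 st; first by rewrite ltW.
    have [|c2 /andP[? ?] E2] := @cauchy t x t0 tx; first by rewrite lexx.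
    rewrite fx wx !sub0r in E2.
    have rr : r c1 < r c2 by apply: r_incr; lra.
    have wts := lt_left s0 (ltW tx) st.
    have := mulr_gt0 (mulr_gt0 (_ : 0 < r c2 - r c1) (_ : 0 < w s - w t)) wt.
    rewrite !subr_gt0 => /(_ rr wts).
    have -> : f s = f t - r c1 * (w t - w s) by lra.
    have -> : f t = r c2 * w t by lra.
    by rewrite -subr_gt0 => H; rewrite -subr_gt0; congr (0 < _): H; ring.
  + have [|c1 /andP[? ?] E1] := @cauchy s x s0 sx; first by rewrite lexx.
    have [|c2 /andP[? ?] E2] := @cauchy x t x0 tx; first by rewrite lexx orbT.
    rewrite fx wx !sub0r in E1; rewrite fx wx !subr0 in E2.
    have rr : r c1 < r c2 by apply: r_incr; lra.
    have -> : f s = r c1 * w s by lra.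
    by rewrite E2 -!mulrA (mulrC (w s)) ltr_pM2r// mulr_gt0.
- have xt : x < t by lra.
  have [|c1 /andP[? ?] E1] := @cauchy x s x0 sx; first by rewrite lexx orbT.
  have [|c2 /andP[? ?] E2] := @cauchy s t s0 st; first by rewrite (ltW sx) orbT.
  rewrite fx wx !subr0 in E1.
  have rr : r c1 < r c2 by apply: r_incr; lra.
  have wts := lt_right s0 (ltW sx) st.
  have := mulr_gt0 (mulr_gt0 (_ : 0 < r c2 - r c1) (_ : 0 < w t - w s)) ws.
  rewrite !subr_gt0 => /(_ rr wts).
  have -> : f t = f s + r c2 * (w t - w s) by lra.
  rewrite E1 -subr_gt0 => H; rewrite -subr_gt0; congr (0 < _): H; ring.
Qed.

End monotone_lhopital.

(** * Positivity of a function whose derivative changes sign at most once *)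

Lemma itv_avoid_neq (R : realType) (a b u x : R) :
  a < u < b -> (b <= x) || (x <= a) -> u != x.
Proof.
move=> /andP[au ub] bxa; apply/eqP => ux; move: au ub; rewrite ux.
by case/orP: bxa => *; lra.
Qed.

(* From any point, [h] decreases monotonically to one of the two ends, where its
   limit is nonnegative. *)
Lemma gt0_of_single_crossing (R : realType) (h dh : R -> R) (x : R) :
  (forall u : R, 0 < u -> {for u, continuous h}) ->
  (forall u : R, 0 < u -> u != x -> is_derive u 1 h (dh u)) ->
  (forall s t : R, 0 < s -> s < t -> s != x -> t != x -> 0 <= dh t -> 0 < dh s) ->
  (forall e v : R, 0 < e -> 0 < v -> exists u, [/\ 0 < u, u < v & - e < h u]) ->
  (forall e v : R, 0 < e -> exists2 u, v < u & - e < h u) ->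
  forall l : R, 0 < l -> 0 < h l.
Proof.
move=> ch h'E sc h0 hoo l l0.
(* Either the derivative is nonnegative somewhere from [l] on, hence positive on all of []0, l[]
   except perhaps at [x], or it is negative from [l] on, again except perhaps at [x]. *)
have [[t [lt tx dt]]|nex] := pselect (exists t, [/\ l <= t, t != x & 0 <= dh t]).
- have incr_aux (a b : R) : 0 < a -> a < b -> b <= l -> (b <= x) || (x <= a) ->
      h a < h b.
    move=> a0 ab bl bxa; apply: (@lt_of_derive_gt0 _ h dh) => // u /andP[au ub].
    + by apply: h'E; [lra|apply: (itv_avoid_neq _ bxa); rewrite au].
    + apply: (sc u t _ _ _ tx dt); [lra|lra|].
      by apply: (itv_avoid_neq _ bxa); rewrite au.
    + by apply: ch; lra.
  (* The derivative is not controlled at [x], so an interval around [x] is cut there. *)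
  have incr (a b : R) : 0 < a -> a < b -> b <= l -> h a < h b.
    move=> a0 ab bl.
    have [bx|xb] := leP b x; first by apply: incr_aux; rewrite // bx.
    have [xa|ax] := leP x a; first by apply: incr_aux; rewrite // xa orbT.
    apply: (@lt_trans _ _ (h x)); apply: incr_aux; rewrite ?lexx ?orbT//; lra.
  (* The limit gives only [0 <= h m]; a point [m] strictly before [l] makes the inequality at [l]
     strict. *)
  have [m l2m] : exists m, m = l / 2 by exists (l / 2).
  have hm : h m < h l by apply: incr; lra.
  apply: le_lt_trans hm; rewrite leNgt; apply/negP => hm.
  have [||u [u0 um hu]] := h0 (- h m) m; [lra..|].
  have : h u < h m by apply: incr; lra.
  lra.
- have dneg (t : R) : l <= t -> t != x -> dh t < 0.
    by move=> lt tx; rewrite ltNge; apply/negP => dt; apply: nex; exists t.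
  have decr_aux (a b : R) : l <= a -> a < b -> (b <= x) || (x <= a) -> h b < h a.
    move=> la ab bxa; apply: (@lt_of_derive_lt0 _ h dh) => // u /andP[au ub].
    + by apply: h'E; [lra|apply: (itv_avoid_neq _ bxa); rewrite au].
    + by apply: dneg; [lra|apply: (itv_avoid_neq _ bxa); rewrite au].
    + by apply: ch; lra.
  have decr (a b : R) : l <= a -> a < b -> h b < h a.
    move=> la ab.
    have [bx|xb] := leP b x; first by apply: decr_aux; rewrite // bx.
    have [xa|ax] := leP x a; first by apply: decr_aux; rewrite // xa orbT.
    apply: (@lt_trans _ _ (h x)); apply: decr_aux; rewrite ?lexx ?orbT//; lra.
  have hm : h (l + 1) < h l by apply: decr; lra.
  apply: le_lt_trans hm; rewrite leNgt; apply/negP => hm.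
  have [|u um hu] := hoo (- h (l + 1)) (l + 1); first lra.
  have : h u < h (l + 1) by apply: decr; lra.
  lra.
Qed.

(** * The Poisson divergence and the slope of the signed log-likelihood *)

Section divergence.
Context {R : realType} (x : R).
Hypothesis x_ge0 : 0 <= x.

Lemma poisson_divergenceE (l : R) : 0 < l ->
  poisson_divergence x l = x * ln x - x * ln l - x + l.
Proof.
move=> l0; rewrite /poisson_divergence.
have [->|x0] := eqVneq x 0; first by rewrite !mul0r !subr0.
have {}x0 : 0 < x by rewrite lt0r x0.
by rewrite ln_div//; ring.
Qed.

Lemma poisson_divergence_diag : poisson_divergence x x = 0.
Proof.
have [x0|x0] := eqVneq x 0.
  by rewrite /poisson_divergence x0 mul0r subr0 addr0.
by rewrite /poisson_divergence divff// ln1; ring.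
Qed.

Lemma is_derive_poisson_divergence (l : R) : 0 < l ->
  is_derive l 1 (poisson_divergence x) (1 - x / l).
Proof.
move=> l0.
apply: (@near_eq_is_derive _ _ _ (fun u => x * ln x - x * ln u - x + u)).
  near=> u; rewrite poisson_divergenceE//.
  by near: u; exact: lt_nbhsr.
have dln := is_derive1_ln l0.
have -> : 1 - x / l = (0 - x *: l^-1 - 0) + 1 by rewrite /GRing.scale/=; ring.
apply: is_deriveD; apply: is_deriveB; apply: is_deriveB.
Unshelve. all: by end_near. Qed.

Lemma poisson_divergence_gt0 (l : R) : 0 < l -> l != x ->
  0 < poisson_divergence x l.
Proof.
move=> l0 lx; have [x0|x0] := eqVneq x 0.
  by rewrite poisson_divergenceE// x0 !mul0r !subr0 add0r.
have {}x0 : 0 < x by rewrite lt0r x0.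
apply: (@valley_gt0 R _ (fun l => 1 - x / l) x _ poisson_divergence_diag)
  => // [u u0|u u0 ux|u u0 xu].
- exact: is_derive_poisson_divergence.
- by rewrite subr_lt0 ltr_pdivlMr// mul1r.
- by rewrite subr_gt0 ltr_pdivrMr// mul1r.
Qed.

Lemma poisson_divergence_ge0 (l : R) : 0 < l -> 0 <= poisson_divergence x l.
Proof.
move=> l0; have [->|lx] := eqVneq l x; first by rewrite poisson_divergence_diag.
by rewrite ltW// poisson_divergence_gt0.
Qed.

(* Minus the derivative of the signed log-likelihood in the mean. *)
Definition slope (l : R) := `|1 - x / l| / Num.sqrt (2 * poisson_divergence x l).

Lemma slope_gt0 (l : R) : 0 < l -> l != x -> 0 < slope l.
Proof.
move=> l0 lx; rewrite divr_gt0//; last first.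
  by rewrite sqrtr_gt0 mulr_gt0// poisson_divergence_gt0.
rewrite normr_gt0 subr_eq0; apply: contraNneq lx => E.
by rewrite -[l]mul1r E divfK// gt_eqF.
Qed.

Lemma sqr_slope (l : R) : 0 < l ->
  slope l ^+ 2 = (1 - x / l) ^+ 2 / (2 * poisson_divergence x l).
Proof.
move=> l0; rewrite /slope expr_div_n sqr_sqrtr ?real_normK ?num_real//.
by rewrite mulr_ge0// poisson_divergence_ge0.
Qed.

(** L'Hopital's rule for the squared slope: the derivatives of [- (1 - x / l) ^+ 2] and of the
    divergence have ratio [- 2 * x / l ^+ 2], which increases. *)
Lemma slope_decr (s t : R) : 0 < s -> s < t -> s != x -> t != x ->
  slope t < slope s.
Proof.
move=> s0 st sx tx; have t0 : 0 < t by lra.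
have Ds := poisson_divergence_gt0 s0 sx; have Dt := poisson_divergence_gt0 t0 tx.
rewrite -ltr_sqr ?nnegrE ?ltW ?slope_gt0// !sqr_slope//.
rewrite ltr_pdivrMr ?mulr_gt0// mulrAC ltr_pdivlMr ?mulr_gt0//.
rewrite !(mulrCA _ 2) ltr_pM2l//.
(* For [x = 0] that ratio is constant, but the divergence is [l] and the squared slope is
   [1 / (2 * l)]. *)
have [x0|x0] := eqVneq x 0.
  by rewrite !poisson_divergenceE// x0 !mul0r !subr0 !add0r expr1n !mul1r.
have {}x0 : 0 < x by rewrite lt0r x0.
suff : - (1 - x / s) ^+ 2 * poisson_divergence x t
       < - (1 - x / t) ^+ 2 * poisson_divergence x s by rewrite !mulNr ltrN2.
pose f (u : R) := - (1 - x / u) ^+ 2.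
apply: (@monotone_lhopital R f _ (fun l => 1 - x / l)
  (fun u => - (2 * x / u ^+ 2)) x _ _ _ _ _ _ _ s t x0 s0 st sx tx).
- move=> u u0.
  have un0 : u != 0 by rewrite gt_eqF.
  have dV : is_derive u 1 (fun v : R => v^-1) (- u ^- 2 *: 1).
    exact: (@is_deriveV _ id).
  have dq : is_derive u 1 (fun v : R => 1 - x / v) (0 - x *: (- u ^- 2 *: 1)).
    by apply: is_deriveB; exact: is_deriveZ.
  apply: (is_derive_eq (is_deriveN (is_deriveX 2 dq))).
  by rewrite /GRing.scale/= expr1; field.
- by move=> u; exact: is_derive_poisson_divergence.
- by rewrite /f divff ?gt_eqF// subrr expr0n oppr0.
- exact: poisson_divergence_diag.
- by move=> u u0 ux; rewrite subr_lt0 ltr_pdivlMr// mul1r.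
- by move=> u u0 xu; rewrite subr_gt0 ltr_pdivrMr// mul1r.
- move=> u v u0 uv; rewrite ltrN2 ltr_pM2l ?mulr_gt0//.
  by rewrite ltf_pV2 ?posrE ?exprn_gt0 ?ltr_sqr ?nnegrE//; lra.
Qed.

Lemma sqr_mul_slope (l : R) : 0 < l ->
  (l * slope l) ^+ 2 = (l - x) ^+ 2 / (2 * poisson_divergence x l).
Proof.
move=> l0; rewrite (exprMn _ l) sqr_slope// mulrA -exprMn mulrBr mulr1 mulrCA.
by rewrite divff ?mulr1// gt_eqF.
Qed.

(** Here the squared quantity is [(l - x) ^+ 2] over twice the divergence, and the derivatives of
    [(l - x) ^+ 2] and of the divergence have ratio [2 * l]. *)
Lemma mul_slope_incr (s t : R) : 0 < x -> 0 < s -> s < t -> s != x -> t != x ->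
  s * slope s < t * slope t.
Proof.
move=> x0 s0 st sx tx; have t0 : 0 < t by lra.
have Ds := poisson_divergence_gt0 s0 sx; have Dt := poisson_divergence_gt0 t0 tx.
have Bs : 0 < s * slope s by rewrite mulr_gt0// slope_gt0.
have Bt : 0 < t * slope t by rewrite mulr_gt0// slope_gt0.
rewrite -ltr_sqr ?nnegrE ?ltW// !sqr_mul_slope//.
rewrite ltr_pdivrMr ?mulr_gt0// mulrAC ltr_pdivlMr ?mulr_gt0//.
rewrite !(mulrCA _ 2) ltr_pM2l//.
pose f (u : R) := (u - x) ^+ 2.
apply: (@monotone_lhopital R f _ (fun l => 1 - x / l) (fun u => 2 * u) x
  _ _ _ _ _ _ _ s t x0 s0 st sx tx).
- move=> u u0.
  have un0 : u != 0 by rewrite gt_eqF.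
  have dq : is_derive u 1 (fun v : R => v - x) (1 - 0) by exact: is_deriveB.
  apply: (is_derive_eq (is_deriveX 2 dq)).
  by rewrite /GRing.scale/= expr1; field.
- by move=> u; exact: is_derive_poisson_divergence.
- by rewrite /f subrr expr0n.
- exact: poisson_divergence_diag.
- by move=> u u0 ux; rewrite subr_lt0 ltr_pdivlMr// mul1r.
- by move=> u u0 xu; rewrite subr_gt0 ltr_pdivrMr// mul1r.
- by move=> u v u0 uv; rewrite ltr_pM2l.
Qed.

(** * The signed log-likelihood as a function of the mean *)

Let G l := signed_log_likelihood l x.

Lemma sqr_signed_log_likelihood (l : R) : 0 < l ->
  G l ^+ 2 = 2 * poisson_divergence x l.
Proof.
move=> l0; rewrite /G /signed_log_likelihood; case: ifP => _; rewrite ?sqrrN;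
  by rewrite sqr_sqrtr// mulr_ge0// poisson_divergence_ge0.
Qed.

Let is_derive_sqrt_divergence (l : R) : 0 < l -> l != x ->
  is_derive l 1 (fun u => Num.sqrt (2 * poisson_divergence x u))
    ((1 - x / l) / Num.sqrt (2 * poisson_divergence x l)).
Proof.
move=> l0 lx.
have dD := is_derive_poisson_divergence l0.
have D0 := poisson_divergence_gt0 l0 lx.
have D20 : 0 < 2 * poisson_divergence x l by rewrite mulr_gt0.
have d2D : is_derive l 1 (fun u => 2 * poisson_divergence x u) (2 * (1 - x / l)).
  exact: is_deriveZ.
have dS := is_derive1_sqrt D20.
have dc := @is_derive1_comp R Num.sqrt (fun u => 2 * poisson_divergence x u) l
  _ _ dS d2D.
apply: (is_derive_eq dc); rewrite invfM; field.
have S0 : Num.sqrt (2 * poisson_divergence x l) != 0 by rewrite gt_eqF ?sqrtr_gt0.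
by rewrite S0 (gt_eqF l0).
Qed.

(** Away from [x] the sign in [G] is locally constant and opposite to that of [1 - x / l], which
    accounts for the absolute value in [slope]. *)
Lemma is_derive_signed_log_likelihood (l : R) : 0 < l -> l != x ->
  is_derive l 1 G (- slope l).
Proof.
move=> l0 lx; have dS := is_derive_sqrt_divergence l0 lx.
move: (lx); case: (ltgtP l x) => // {}lx' _.
- rewrite /slope ltr0_norm ?mulNr ?opprK; last first.
    by rewrite subr_lt0 ltr_pdivlMr// mul1r.
  apply: near_eq_is_derive dS.
  near=> u; rewrite /G /signed_log_likelihood ifF//; apply/negbTE.
  by rewrite -leNgt ltW//; near: u; exact: lt_nbhsl.
- rewrite /slope gtr0_norm; last by rewrite subr_gt0 ltr_pdivrMr// mul1r.
  apply: near_eq_is_derive (is_deriveN dS).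
  near=> u; rewrite /G /signed_log_likelihood ifT//.
  by near: u; exact: lt_nbhsr.
Unshelve. all: by end_near. Qed.

Lemma continuous_signed_log_likelihood (l : R) : 0 < l ->
  {for l, continuous G}.
Proof.
move=> l0; have [lx|lx] := eqVneq l x; last first.
  exact: is_derive_continuous (is_derive_signed_log_likelihood l0 lx).
have G0 : G l = 0.
  by rewrite /G /signed_log_likelihood lx ltxx poisson_divergence_diag mulr0
     sqrtr0.
(* At [l = x] the function [|G|] is continuous and vanishes, which forces [G] to tend to 0. *)
have GE : (fun u => `|G u|) = Num.sqrt \o (fun u => 2 * poisson_divergence x u).
  apply/funext => u; rewrite /G /signed_log_likelihood/=.
  by case: ifP => _; rewrite ?normrN ger0_norm.
have c2D : {for l, continuous (fun u => 2 * poisson_divergence x u)}.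
  exact: is_derive_continuous (is_deriveZ 2 (is_derive_poisson_divergence l0)).
have := @continuous_comp _ _ _ _ Num.sqrt l c2D (@sqrt_continuous R _).
rewrite -GE /prop_for /continuous_at G0 normr0 => cG.
exact/norm_cvg0P.
Qed.

(** The inequality [ln y <= y - 1] at [y = l / (2 * x)]; the factor 2 leaves a linear growth in
    [l]. *)
Lemma poisson_divergence_ge_half (l : R) : 0 < l ->
  l / 2 - x * ln 2 <= poisson_divergence x l.
Proof.
move=> l0; rewrite poisson_divergenceE//.
have [->|x0] := eqVneq x 0; first by rewrite !mul0r !subr0 add0r; lra.
have {}x0 : 0 < x by rewrite lt0r x0.
have l2x : 0 < l / (2 * x) by rewrite divr_gt0// mulr_gt0.
have : ln (1 + (l / (2 * x) - 1)) <= l / (2 * x) - 1 by apply: le_ln1Dx; lra.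
rewrite addrC subrK ln_div ?posrE ?mulr_gt0// lnM ?posrE//.
rewrite -(ler_pM2l x0) !mulrBr mulrDr mulr1.
have -> : x * (l / (2 * x)) = l / 2 by field; rewrite gt_eqF.
lra.
Qed.

End divergence.

(** * The standard normal distribution function *)

Section std_normal.
Context {R : realType}.
Local Open Scope measure_display_scope.

Definition Phi (z : R) : R := fine (std_normal_cdf z).

(** The identity as a random variable under the normal law: its [cdf] is [std_normal_cdf], so the
    general facts on [cdf] apply. *)
Let idTR : measurableTypeR R -> R := idfun.

#[local] HB.instance Definition _ :=
  @isMeasurableFun.Build _ _ _ _ idTR (@measurable_id _ _ setT).

Let std_normal : probability (measurableTypeR R) R := normal_prob 0 1.

Let cdf_id (z : R) : cdf (idTR : {RV std_normal >-> R}) z = std_normal_cdf z.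
Proof. by []. Qed.

Lemma std_normal_cdfE (z : R) : std_normal_cdf z = (Phi z)%:E.
Proof. by rewrite /Phi fineK// -cdf_id fin_num_measure. Qed.

Lemma Phi_ge0 (z : R) : 0 <= Phi z.
Proof. by rewrite -lee_fin -std_normal_cdfE -cdf_id cdf_ge0. Qed.

Lemma Phi_le1 (z : R) : Phi z <= 1.
Proof. by rewrite -lee_fin -std_normal_cdfE -cdf_id cdf_le1. Qed.

Lemma Phi_cvgy : Phi z @[z --> +oo] --> (1 : R).
Proof. exact/fine_cvg/(cvg_cdfy1 (idTR : {RV std_normal >-> R})). Qed.

Lemma Phi_cvgNy : Phi z @[z --> -oo] --> (0 : R).
Proof. exact/fine_cvg/(cvg_cdfNy0 (idTR : {RV std_normal >-> R})). Qed.

Lemma std_normal_pdfE (z : R) :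
  normal_pdf 0 1 z = normal_peak 1 * expR (- (z ^+ 2 / 2)).
Proof.
by rewrite normal_pdfE ?oner_eq0// /normal_fun subr0 expr1n mulNr.
Qed.

Lemma is_derive_Phi (z : R) : is_derive z 1 Phi (normal_pdf 0 1 z).
Proof.
have zz1 : z < z + 1 by lra.
have [|||dP P'] := @continuous_FTC1 R (normal_pdf 0 1) -oo%O z (z + 1) zz1.
- apply: integrableS (integrable_normal_pdf 0 1) => //.
- by rewrite ltNyr.
- by apply: continuous_normal_pdf; rewrite oner_eq0.
- by apply: DeriveDef; [exact: dP|rewrite -derive1E].
Qed.

(** The density is positive, so [Phi] exceeds its nonnegative value at [z - 1]. This settles the
    lower bound for [k = 0]. *)
Lemma Phi_gt0 (z : R) : 0 < Phi z.
Proof.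
apply: (@le_lt_trans _ _ (Phi (z - 1))); first exact: Phi_ge0.
apply: (@lt_of_derive_gt0 R Phi (normal_pdf 0 1)) => [|u _|u _|u _].
- by lra.
- exact: is_derive_Phi.
- by rewrite std_normal_pdfE mulr_gt0 ?expR_gt0// normal_peak_gt0// oner_eq0.
- exact: is_derive_continuous (is_derive_Phi u).
Qed.

End std_normal.

(** * Poisson probabilities as functions of the mean *)

Section poisson_cdf.
Context {R : realType}.
Implicit Types (n k : nat) (l : R).

(** Unlike [poisson_pmf] it does not test the sign of [l], so it is differentiable everywhere. *)
Definition poisson_term n l : R := l ^+ n / n`!%:R * expR (- l).

Definition poisson_lt n l : R := \sum_(i < n) poisson_term i l.

Lemma poisson_prob_lt n l : 0 < l ->
  poisson_prob l 0%N `I_n = (poisson_lt n l)%:E.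
Proof.
move=> l0; rewrite /poisson_prob l0 esum_fset; last 2 first.
- exact: finite_II.
- by move=> i _; rewrite lee_fin poisson_pmf_ge0.
rewrite -(fsbig_ord _ n (fun i => (poisson_pmf l i)%:E)) sumEFin.
by congr EFin; apply: eq_bigr => i _; rewrite /poisson_pmf l0.
Qed.

Lemma poisson_term_gt0 n l : 0 < l -> 0 < poisson_term n l.
Proof.
by move=> l0; rewrite mulr_gt0 ?expR_gt0// divr_gt0 ?exprn_gt0// ltr0n fact_gt0.
Qed.

Lemma poisson_lt_le1 n l : 0 < l -> poisson_lt n l <= 1.
Proof.
move=> l0; rewrite -lee_fin -poisson_prob_lt//.
exact: (probability_le1 (poisson_prob l 0)).
Qed.

(** The derivative of each term is the preceding term minus the term itself, so the sum
    telescopes. *)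
Lemma is_derive_poisson_lt n l :
  is_derive l 1 (poisson_lt n.+1) (- poisson_term n l).
Proof.
have dE : is_derive l 1 (fun u => expR (- u)) (- expR (- l)).
  have dN : is_derive l 1 (-%R : R -> R) (- 1) by exact: is_deriveNid.
  by apply: (is_derive_eq (is_derive1_comp (is_derive_expR _) dN)); rewrite mulrN1.
have dT k : is_derive l 1 (poisson_term k)
    ((k%:R * l ^+ k.-1) / k`!%:R * expR (- l) - poisson_term k l).
  have dX : is_derive l 1 (fun u : R => u ^+ k / k`!%:R)
      ((k%:R * l ^+ k.-1) / k`!%:R).
    have dXk : is_derive l 1 (fun u : R => u ^+ k) (k%:R * l ^+ k.-1).
      by split; [exact: exprn_derivable|rewrite exp_derive scaler1].
    rewrite (_ : (fun u : R => _) = k`!%:R^-1 \*: (fun u : R => u ^+ k)).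
      by apply: (is_derive_eq (is_deriveZ _ dXk)); rewrite /GRing.scale/= mulrC.
    by apply/funext => u; rewrite /= mulrC.
  apply: (is_derive_eq (is_deriveM dX dE)).
  by rewrite /GRing.scale/= /poisson_term; ring.
elim: n => [|n IH].
  rewrite (_ : poisson_lt 1 = poisson_term 0); last first.
    by apply/funext => u; rewrite /poisson_lt big_ord1.
  by apply: (is_derive_eq (dT 0%N)); rewrite !mul0r sub0r.
rewrite (_ : poisson_lt n.+2 = poisson_lt n.+1 + poisson_term n.+1); last first.
  by apply/funext => u; rewrite /poisson_lt big_ord_recr.
apply: (is_derive_eq (is_deriveD IH (dT n.+1))).
rewrite /poisson_term factS natrM /=; field.
by rewrite pnatr_eq0 -lt0n fact_gt0 nat1r pnatr_eq0.
Qed.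

Lemma poisson_term_le n l : 0 < l -> poisson_term n l <= n.+1%:R / l.
Proof.
move=> l0; rewrite /poisson_term expRN ler_pdivrMr ?expR_gt0//.
have := expR_ge1Dxn n (ltW l0) => /(le_trans _) H.
rewrite -(ler_pM2r (_ : 0 < l / n.+1%:R)) ?divr_gt0//.
have -> : n.+1%:R / l * expR l * (l / n.+1%:R) = expR l.
  have N0 : n.+1%:R != 0 :> R by rewrite pnatr_eq0.
  by move: (n.+1%:R : R) N0 => N N0; field; rewrite N0 gt_eqF.
apply: H; rewrite factS natrM exprSr invfM.
have -> : l ^+ n / n`!%:R * (l / n.+1%:R) = l ^+ n * l * (n.+1%:R^-1 / n`!%:R).
  by ring.
by rewrite lerDr.
Qed.

Lemma poisson_lt_le n l : 0 < l -> poisson_lt n l <= n%:R ^+ 2 / l.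
Proof.
move=> l0; rewrite /poisson_lt.
apply: (@le_trans _ _ (\sum_(i < n) (n%:R / l))).
  apply: ler_sum => i _; apply: le_trans (poisson_term_le _ l0) _.
  by rewrite ler_pM2r ?invr_gt0// ler_nat.
by rewrite sumr_const card_ord -[leLHS]mulr_natr mulrAC expr2.
Qed.

End poisson_cdf.

(** * Comparison of the Gaussian and Poisson distribution functions *)

Section comparison.
Context {R : realType} (k : nat).
Local Notation x := (k%:R : R).
Local Notation G := (fun l : R => signed_log_likelihood l x).

Let x_ge0 : 0 <= x. Proof. by []. Qed.

(* The normalising ratio k! e^k / (k^k sqrt (2 pi)) of the Gaussian density at
   [G l] to the Poisson weight of [k]; it does not depend on [l]. *)
Let W : R := normal_peak 1 * expR (x - x * ln x) * k`!%:R.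

Let W_gt0 : 0 < W.
Proof.
rewrite mulr_gt0 ?ltr0n ?fact_gt0// mulr_gt0 ?expR_gt0//.
by rewrite normal_peak_gt0// oner_eq0.
Qed.

(** Half the square of [G l] is the divergence, whose exponential splits into [l ^+ k * expR (- l)]
    and a factor free of [l]. *)
Let normal_pdf_at (l : R) : 0 < l ->
  normal_pdf 0 1 (G l) = W * poisson_term k l.
Proof.
move=> l0; rewrite std_normal_pdfE sqr_signed_log_likelihood// (mulrC 2).
rewrite mulfK ?pnatr_eq0// poisson_divergenceE//.
have -> : - (x * ln x - x * ln l - x + l) = (x - x * ln x) + x * ln l + (- l).
  by ring.
rewrite /W /poisson_term !expRD expRM_natl lnK ?posrE//; field.
by rewrite pnatr_eq0 -lt0n fact_gt0.
Qed.

Let is_derive_PhiG (l : R) : 0 < l -> l != x ->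
  is_derive l 1 (fun u => Phi (G u)) (- (W * poisson_term k l * slope x l)).
Proof.
move=> l0 lx; rewrite -normal_pdf_at//.
have dG := is_derive_signed_log_likelihood x_ge0 l0 lx.
have dP := is_derive_Phi (G l).
apply: (is_derive_eq (@is_derive1_comp R Phi G l _ _ dP dG)).
by rewrite mulrN.
Qed.

Let continuous_PhiG (l : R) : 0 < l -> {for l, continuous (fun u => Phi (G u))}.
Proof.
move=> l0; apply: (@continuous_comp _ _ _ G Phi).
  exact: continuous_signed_log_likelihood.
exact: is_derive_continuous (is_derive_Phi _).
Qed.

Let continuous_poisson_lt n (l : R) : {for l, continuous (poisson_lt n.+1)}.
Proof. exact: is_derive_continuous (is_derive_poisson_lt n l). Qed.

Lemma Phi_signed_log_likelihood_small (e v : R) : 0 < e ->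
  exists2 u, [/\ 0 < u, v < u & x < u] & Phi (G u) < e.
Proof.
move=> e0.
have [M [_ HM]] := @Phi_cvgNy R _ (lt_nbhsl e0).
have ln2 : 0 <= ln 2 :> R by apply: ln_ge0; rewrite ler1n.
have xl2 := mulr_ge0 x_ge0 ln2; have M2 := sqr_ge0 M; have v0 := normr_ge0 v.
have vv := ler_norm v.
(* Twice the divergence at [u] is at least [u - 2 * (x * ln 2)], hence exceeds [M ^+ 2], so
   [G u < M]. *)
pose u : R := `|v| + x + M ^+ 2 + 2 * (x * ln 2) + 1.
have u0 : 0 < u by rewrite /u; have := x_ge0; lra.
have vu : v < u by rewrite /u; have := x_ge0; lra.
have xu : x < u by rewrite /u; have := x_ge0; lra.
have D0 : 0 < 2 * poisson_divergence x u.
  by rewrite mulr_gt0// poisson_divergence_gt0// gt_eqF.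
exists u => //; apply: HM; rewrite /signed_log_likelihood xu.
rewrite ltrNl; apply: le_lt_trans (ler_norm (- M)) _.
rewrite normrN -sqrtr_sqr ltr_sqrt//.
have := poisson_divergence_ge_half x_ge0 u0; rewrite {1}/u; have := x_ge0; lra.
Qed.

Lemma Phi_signed_log_likelihood_large (e v : R) : (0 < k)%N -> 0 < e -> 0 < v ->
  exists2 u, [/\ 0 < u, u < v & u < x] & 1 - e < Phi (G u).
Proof.
move=> k0 e0 v0; have x0 : 0 < x by rewrite ltr0n.
have e1 : 1 - e < 1 :> R by lra.
have [M [_ HM]] := @Phi_cvgy R _ (lt_nbhsr e1).
have M2 := sqr_ge0 M.
(* Near 0 the divergence is governed by [- x * ln u]; for [u <= expR (- c)] it exceeds [M ^+ 2 + 1],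
   so [M < G u]. *)
pose c := (M ^+ 2 + x - x * ln x + 1) / x.
pose u : R := Num.min (v / 2) (Num.min (x / 2) (expR (- c))).
have u0 : 0 < u by rewrite !lt_min expR_gt0 !divr_gt0.
have uv : u < v by rewrite gt_min; apply/orP; left; lra.
have ux : u < x by rewrite !gt_min; apply/orP; right; apply/orP; left; lra.
have uc : u <= expR (- c) by rewrite !ge_min lexx !orbT.
have D0 : 0 < 2 * poisson_divergence x u.
  by rewrite mulr_gt0// poisson_divergence_gt0// lt_eqF.
exists u => //; apply: HM; rewrite /signed_log_likelihood (ltNge x u) (ltW ux)/=.
apply: le_lt_trans (ler_norm M) _.
rewrite -sqrtr_sqr ltr_sqrt//.
rewrite poisson_divergenceE//.
have lnu : ln u <= - c by rewrite -[leRHS]expRK ler_ln ?posrE ?expR_gt0.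
have : x * ln u <= - (x * c) by rewrite -mulrN ler_pM2l.
rewrite /c mulrCA divff ?gt_eqF// mulr1; lra.
Qed.

Lemma Phi_lt_poisson (l : R) : 0 < l -> Phi (G l) < poisson_lt k.+1 l.
Proof.
move=> l0; rewrite -subr_gt0; move: l l0.
apply: (@gt0_of_single_crossing R (fun l => poisson_lt k.+1 l - Phi (G l))
  (fun l => poisson_term k l * (W * slope x l - 1)) x).
- by move=> u u0; apply: continuousB; [exact: continuous_poisson_lt|
    exact: continuous_PhiG].
- move=> u u0 ux.
  apply: (is_derive_eq (is_deriveB (is_derive_poisson_lt k u)
    (is_derive_PhiG u0 ux))); ring.
- move=> s t s0 st sx tx; have t0 : 0 < t by lra.
  rewrite pmulr_rge0 ?poisson_term_gt0// subr_ge0 => H.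
  rewrite pmulr_rgt0 ?poisson_term_gt0// subr_gt0 (le_lt_trans H)//.
  by rewrite ltr_pM2l// slope_decr.
(* Near mean 0 the mass at 0 alone suffices: [expR (- u) >= 1 - u > 1 - e], while [Phi] is at most
   1. *)
- move=> e v e0 v0; pose u : R := Num.min v e / 2.
  have m0 : 0 < Num.min v e by rewrite lt_min v0.
  have mv : Num.min v e <= v by rewrite ge_min lexx.
  have me : Num.min v e <= e by rewrite ge_min lexx orbT.
  exists u; split; [rewrite /u; lra|rewrite /u; lra|].
  have u0 : 0 < u by rewrite /u; lra.
  have := Phi_le1 (G u); have := expR_ge1Dx (- u).
  have : expR (- u) <= poisson_lt k.+1 u.
    rewrite /poisson_lt big_ord_recl {1}/poisson_term expr0 fact0 divr1 mul1r.
    by rewrite lerDl sumr_ge0// => i _; rewrite ltW// poisson_term_gt0.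
  have ue : u < e by rewrite /u; lra.
  lra.
- move=> e v e0.
  have [u [u0 vu _] Pu] := Phi_signed_log_likelihood_small v e0.
  exists u => //.
  have : 0 <= poisson_lt k.+1 u.
    by rewrite sumr_ge0// => i _; rewrite ltW// poisson_term_gt0.
  lra.
Qed.

Lemma poisson_lt_Phi (l : R) : 0 < l -> poisson_lt k l < Phi (G l).
Proof.
(* For [k = 0] the Poisson sum is empty; otherwise its last term has index [k.-1]. *)
move=> l0; have [k0|k0] := posnP k.
  by rewrite [in poisson_lt k]k0 /poisson_lt big_ord0 Phi_gt0.
have x0 : 0 < x by rewrite ltr0n.
rewrite -subr_gt0; move: l l0.
have kE := prednK k0.
apply: (@gt0_of_single_crossing R (fun l => Phi (G l) - poisson_lt k l)
  (fun l => poisson_term k.-1 l * (1 - W / x * (l * slope x l))) x).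
- move=> u u0; apply: continuousB; first exact: continuous_PhiG.
  by rewrite -[in poisson_lt k]kE; exact: continuous_poisson_lt.
- move=> u u0 ux.
  have := is_derive_poisson_lt k.-1 u; rewrite kE => dS.
  apply: (is_derive_eq (is_deriveB (is_derive_PhiG u0 ux) dS)).
  (* Factoring out the weight of [k.-1] instead of [k] brings in [u / x], whence the product
     [l * slope x l]. *)
  have -> : poisson_term k u = poisson_term k.-1 u * (u / x).
    rewrite -[in LHS]kE /poisson_term factS natrM exprSr kE; field.
    by rewrite !pnatr_eq0 -!lt0n k0 fact_gt0.
  by ring.
- move=> s t s0 st sx tx; have t0 : 0 < t by lra.
  rewrite pmulr_rge0 ?poisson_term_gt0// subr_ge0 => H.
  rewrite pmulr_rgt0 ?poisson_term_gt0// subr_gt0; apply: lt_le_trans H.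
  by rewrite ltr_pM2l ?divr_gt0// mul_slope_incr.
- move=> e v e0 v0.
  have [u [u0 uv _] Pu] := Phi_signed_log_likelihood_large k0 e0 v0.
  exists u; split => //; have := poisson_lt_le1 k u0; lra.
- move=> e v e0.
  have q0 : 0 <= x ^+ 2 / e by rewrite divr_ge0 ?sqr_ge0 ?ltW.
  have v0 := normr_ge0 v; have vv := ler_norm v.
  (* Beyond [x ^+ 2 / e] the bound [x ^+ 2 / u] on the Poisson sum is below [e]. *)
  pose u : R := `|v| + x ^+ 2 / e + 1.
  have u0 : 0 < u by rewrite /u; lra.
  exists u; first by rewrite /u; lra.
  have := Phi_ge0 (G u); have := poisson_lt_le k u0.
  have : x ^+ 2 / u < e by rewrite ltr_pdivrMr// mulrC -ltr_pdivrMr// /u; lra.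
  lra.
Qed.

End comparison.

(** * The inequalities for a Poisson random variable *)

Theorem corollary12 (d : measure_display) (T : measurableType d)
    (R : realType) (P : probability T R) (X : {RV P >-> nat}) (lam : R)
    (lam_gt0 : 0 < lam) (X_poisson : poisson_distributed X lam) (k : nat) :
  (P [set t | (X t < k)%N] < std_normal_cdf (signed_log_likelihood lam k%:R))%E
  /\
  (std_normal_cdf (signed_log_likelihood lam k%:R) < P [set t | (X t <= k)%N])%E.
Proof.
have PX n : P [set t | (X t < n)%N] = (poisson_lt n lam)%:E.
  by rewrite -poisson_prob_lt// -X_poisson.
(* The event [X <= k] is [X < k.+1] by definition of the order on [nat]. *)
rewrite (PX k) (PX k.+1) std_normal_cdfE !lte_fin.
by split; [exact: poisson_lt_Phi|exact: Phi_lt_poisson].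
Qed.
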